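(* Let $\mathfrak{p}$ be a finite prime of $k$ and let $x$ be any section of $\mathcal{L}_{\mathfrak{p}}$. Then for all $g,g'\in G$, $$\lambda^{x}_{\mathfrak{p}}(gg')=\lambda^{x}_{\mathfrak{p}}(g)+g.\lambda^{x}_{\mathfrak{p}}(g')$$ in $\mathrm{Map}(\mathcal{F}_{\mathfrak{p}},\mathbb{Z}/N\mathbb{Z})$. In other words, $\lambda^{x}_{\mathfrak{p}}\in Z^1(G,\mathrm{Map}(\mathcal{F}_{\mathfrak{p}},\mathbb{Z}/N\mathbb{Z}))$.
   Context: Fix an integer $N>1$ and a primitive $N$-th root of unity $\zeta_N\in\mathbb{C}$, and identify $\mathbb{Z}/N\mathbb{Z}$ with the group $\mu_N$ of $N$-th roots of unity via $m\mapsto\zeta_N^m$. Let $k\subset\mathbb{C}$ be a number field containing $\mu_N$. Let $G$ be a finite group and let $c\in Z^3(G,\mathbb{Z}/N\mathbb{Z})$ be a fixed $3$-cocycle, where $G$ acts trivially on $\mathbb{Z}/N\mathbb{Z}$. For a profinite group $\Pi$, $C^n(\Pi,\mathbb{Z}/N\mathbb{Z})$ denotes the group of continuous inhomogeneous $n$-cochains with trivial coefficients, $d$ denotes the usual coboundary, and $Z^n,B^n,H^n$ denote cocycles, coboundaries and cohomology. For $\alpha\in C^n(G,\mathbb{Z}/N\mathbb{Z})$ and a continuous homomorphism $\rho:\Pi\to G$, let $\alpha\circ\rho\in C^n(\Pi,\mathbb{Z}/N\mathbb{Z})$ be the cochain $(\gamma_1,\dots,\gamma_n)\mapsto\alpha(\rho(\gamma_1),\dots,\rho(\gamma_n))$.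 For $g\in G$, let $h_g\in C^2(G,\mathbb{Z}/N\mathbb{Z})/B^2(G,\mathbb{Z}/N\mathbb{Z})$ be the class of the $2$-cochain $$(g_1,g_2)\mapsto c(g,g^{-1}g_1g,g^{-1}g_2g)-c(g_1,g,g^{-1}g_2g)+c(g_1,g_2,g).$$ A $\mathbb{Z}/N\mathbb{Z}$-torsor is a set with a simply transitive right action $(t,m)\mapsto t.m$. For elements $s,t$ of a torsor, $s-t\in\mathbb{Z}/N\mathbb{Z}$ denotes the unique $m$ with $s=t.m$. For a finite prime $\mathfrak{p}$ of $k$, let $\Pi_{\mathfrak{p}}=\mathrm{Gal}(\bar k_{\mathfrak{p}}/k_{\mathfrak{p}})$ and $\mathcal{F}_{\mathfrak{p}}=\mathrm{Hom}_{\rm cont}(\Pi_{\mathfrak{p}},G)$, with the right $G$-action $\rho.g=g^{-1}\rho g$. For $\rho\in\mathcal{F}_{\mathfrak{p}}$, put $$\mathcal{L}_{\mathfrak{p}}(\rho)=\{\beta\in C^2(\Pi_{\mathfrak{p}},\mathbb{Z}/N\mathbb{Z}):d\beta=c\circ\rho\}/B^2(\Pi_{\mathfrak{p}},\mathbb{Z}/N\mathbb{Z}).$$ This set is nonempty and is a $\mathbb{Z}/N\mathbb{Z}$-torsor via $\alpha.m=\alpha+z$, where $z\in Z^2(\Pi_{\mathfrak{p}},\mathbb{Z}/N\mathbb{Z})$ satisfies $\mathrm{inv}_{\mathfrak{p}}([z])=m$. Here $\mathrm{inv}_{\mathfrak{p}}:H^2(\Pi_{\mathfrak{p}},\mathbb{Z}/N\mathbb{Z})=H^2(k_{\mathfrak{p}},\mu_N)\xrightarrow{\sim}\mathbb{Z}/N\mathbb{Z}$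 is the local invariant (Brauer group) isomorphism. Let $\mathcal{L}_{\mathfrak{p}}=\bigsqcup_{\rho\in\mathcal{F}_{\mathfrak{p}}}\mathcal{L}_{\mathfrak{p}}(\rho)$. Give it the right $G$-action $\alpha.g=\alpha+h_g\circ\rho\in\mathcal{L}_{\mathfrak{p}}(\rho.g)$ for $\alpha\in\mathcal{L}_{\mathfrak{p}}(\rho)$. A section of $\mathcal{L}_{\mathfrak{p}}$ is a map $x:\mathcal{F}_{\mathfrak{p}}\to\mathcal{L}_{\mathfrak{p}}$ with $x(\rho)\in\mathcal{L}_{\mathfrak{p}}(\rho)$ for all $\rho$. For such a section $x$, define $\lambda^x_{\mathfrak{p}}(g,\rho)=x(\rho).g-x(\rho.g)\in\mathbb{Z}/N\mathbb{Z}$, and let $\lambda^x_{\mathfrak{p}}(g)\in\mathrm{Map}(\mathcal{F}_{\mathfrak{p}},\mathbb{Z}/N\mathbb{Z})$ be the map $\rho\mapsto\lambda^x_{\mathfrak{p}}(g,\rho)$. $G$ acts on $\mathrm{Map}(\mathcal{F}_{\mathfrak{p}},\mathbb{Z}/N\mathbb{Z})$ on the left by $(g.\psi)(\rho)=\psi(\rho.g)$. *)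

(* Defs.v *)
From HB Require Import structures.
From mathcomp Require Import all_boot all_order all_fingroup all_algebra.
From mathcomp Require Import all_field.
From mathcomp Require Import ring_quotient generic_quotient complex.
From mathcomp Require Import all_classical reals topology.
From mathcomp Require Import ring.

Set Implicit Arguments.
Unset Strict Implicit.
Unset Printing Implicit Defensive.

Import Order.TTheory GRing.Theory Num.Theory.
Import ring_quotient.Quotient.

Local Open Scope classical_set_scope.
Local Open Scope ring_scope.

HB.mixin Record isTopologicalGroup T of Topological T & monoid.Group T := {
  mulg_continuous : continuous (fun x : T * T => (x.1 * x.2)%g);
  invg_continuous : continuous (fun x : T => (x^-1)%g)
}.

#[short(type="topGroupType")]
HB.structure Definition TopologicalGroup :=
  {T of Topological T & monoid.Group T & isTopologicalGroup T}.

Section DiscreteGroup.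
Variable G : finGroupType.
Local Notation D := (discrete_topology G).

HB.instance Definition _ := monoid.Group.copy D G.

Lemma discrete_nbhs1 (x : D) : nbhs x [set x].
Proof. exact: discrete_set1. Qed.

Lemma discrete_continuous (T : topologicalType) (f : D -> T) : continuous f.
Proof.
move=> x A Af; apply: (@filterS _ (nbhs x) _ [set x] (f @^-1` A)).
  by move=> y -> /=; exact: (nbhs_singleton Af).
exact: discrete_nbhs1.
Qed.

Lemma discrete_pair_nbhs1 (x : D * D) : nbhs x [set x].
Proof.
exists ([set x.1], [set x.2]); first by split; exact: discrete_nbhs1.
by move=> [a b] [/= -> ->]; case: x.
Qed.

Lemma discrete_pair_continuous (T : topologicalType) (f : D * D -> T) :
  continuous f.
Proof.
move=> x A Af; apply: (@filterS _ (nbhs x) _ [set x] (f @^-1` A)).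
  by move=> y -> /=; exact: (nbhs_singleton Af).
exact: discrete_pair_nbhs1.
Qed.

HB.instance Definition _ := isTopologicalGroup.Build D
  (@discrete_pair_continuous _ _) (@discrete_continuous _ _).

End DiscreteGroup.

(* continuity of a map into the discrete set A *)
Definition locally_constant (T : topologicalType) (A : Type) (f : T -> A) :=
  forall x : T, \forall y \near x, f y = f x.

Section LocallyConstant.
Variables (T : topologicalType) (A : zmodType).

Definition lcfun_pred : {pred T -> A} := fun f => `[< locally_constant f >].

Lemma lcfun_zmod_closed : zmod_closed lcfun_pred.
Proof.
split; first by apply/asboolP => x; near=> y.
move=> f g /asboolP lf /asboolP lg; apply/asboolP => x.
near=> y; rewrite /= /GRing.add /GRing.opp /=.
by congr (_ - _); near: y; [exact: lf|exact: lg].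
Unshelve. all: by end_near. Qed.

HB.instance Definition _ := GRing.isZmodClosed.Build (T -> A) lcfun_pred
  lcfun_zmod_closed.

Definition lcfun := {f : T -> A | f \in lcfun_pred}.
HB.instance Definition _ := SubChoice.on lcfun.
HB.instance Definition _ := [SubChoice_isSubZmodule of lcfun by <:].

End LocallyConstant.

Lemma lc_comp (T U : topologicalType) (A : zmodType) (f : U -> A) (u : T -> U) :
  continuous u -> f \in @lcfun_pred U A -> f \o u \in @lcfun_pred T A.
Proof.
move=> uc /asboolP lf; apply/asboolP => x.
exact: (uc x _ (lf (u x))).
Qed.

Section Cochains.
Variables (Pi : topGroupType) (A : zmodType).

(* The coefficient module carries the trivial action. *)
Definition d1 (f : Pi -> A) : Pi * Pi -> A :=
  fun '(a, b) => f b - f (a * b)%g + f a.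

Definition d2 (f : Pi * Pi -> A) : Pi * Pi * Pi -> A :=
  fun '(a, b, c) =>
    f (b, c) - f ((a * b)%g, c) + f (a, (b * c)%g) - f (a, b).

Definition d3 (f : Pi * Pi * Pi -> A) : Pi * Pi * Pi * Pi -> A :=
  fun '(a, b, c, e) =>
    f (b, c, e) - f ((a * b)%g, c, e) + f (a, (b * c)%g, e)
    - f (a, b, (c * e)%g) + f (a, b, c).

Definition C1 := lcfun Pi A.
Definition C2 := lcfun (Pi * Pi)%type A.

Definition B2 : {pred C2} := fun b => `[< exists a : C1, val b = d1 (val a) >].

Lemma d1B (f g : Pi -> A) : d1 (f - g) = d1 f - d1 g.
Proof.
apply/funext => -[a b]; rewrite /d1 /=.
rewrite -[LHS]/((f b - g b) - (f (a * b)%g - g (a * b)%g) + (f a - g a)).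
rewrite -[RHS]/((f b - f (a * b)%g + f a) - (g b - g (a * b)%g + g a)).
by rewrite !opprD !opprK [RHS]addrACA; congr (_ + _); exact: addrACA.
Qed.

Lemma d2B (f g : Pi * Pi -> A) : d2 (f - g) = d2 f - d2 g.
Proof.
apply/funext => -[[a b] c]; rewrite /d2 /=.
rewrite -[LHS]/((f (b, c) - g (b, c)) - (f ((a * b)%g, c) - g ((a * b)%g, c))
  + (f (a, (b * c)%g) - g (a, (b * c)%g)) - (f (a, b) - g (a, b))).
rewrite -[RHS]/((f (b, c) - f ((a * b)%g, c) + f (a, (b * c)%g) - f (a, b))
  - (g (b, c) - g ((a * b)%g, c) + g (a, (b * c)%g) - g (a, b))).
rewrite !opprD !opprK [RHS]addrACA; congr (_ + _); rewrite [RHS]addrACA.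
by congr (_ + _); exact: addrACA.
Qed.

Lemma d2D (f g : Pi * Pi -> A) : d2 (f + g) = d2 f + d2 g.
Proof.
have d2N e : d2 (- e) = - d2 e.
  by rewrite -[- e]add0r d2B -[X in d2 X](subrr 0) d2B subrr sub0r.
by rewrite -[g in LHS]opprK d2B d2N opprK.
Qed.

Lemma B2_zmod_closed : zmod_closed B2.
Proof.
split.
  apply/asboolP; exists 0; rewrite !raddf0.
  by rewrite -[X in d1 X](subrr 0) d1B subrr.
move=> b b' /asboolP[f fE] /asboolP[g gE]; apply/asboolP; exists (f - g).
by rewrite !raddfB /= d1B fE gE.
Qed.

HB.instance Definition _ := GRing.isZmodClosed.Build C2 B2 B2_zmod_closed.

Definition C2B2 := quot B2.
HB.instance Definition _ := GRing.Zmodule.on C2B2.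

Definition class2 (b : C2) : C2B2 := (\pi_(quot B2) b)%qT.

(* H^2(Pi, A), as a subgroup of C^2(Pi, A) / B^2(Pi, A) *)
Definition H2_pred : {pred C2B2} :=
  fun x => `[< exists z : C2, d2 (val z) = 0 /\ x = class2 z >].

Lemma H2_zmod_closed : zmod_closed H2_pred.
Proof.
split.
  apply/asboolP; exists 0; rewrite /class2 !raddf0; split=> //.
  by rewrite -[X in d2 X](subrr 0) d2B subrr.
move=> _ _ /asboolP[f [fE ->]] /asboolP[g [gE ->]].
apply/asboolP; exists (f - g).
by rewrite /class2 !raddfB /= d2B fE gE subrr.
Qed.

HB.instance Definition _ := GRing.isZmodClosed.Build C2B2 H2_pred
  H2_zmod_closed.

Definition H2 := {x : C2B2 | x \in H2_pred}.
HB.instance Definition _ := SubChoice.on H2.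
HB.instance Definition _ := [SubChoice_isSubZmodule of H2 by <:].

End Cochains.

Definition conthom_pred (Pi G : topGroupType) : {pred Pi -> G} :=
  fun rho => `[< continuous rho /\
                 forall a b, rho (a * b)%g = (rho a * rho b)%g >].

Definition conthom (Pi G : topGroupType) :=
  {rho : Pi -> G | rho \in @conthom_pred Pi G}.
Definition conthom_fun Pi G (rho : conthom Pi G) : Pi -> G := val rho.
Coercion conthom_fun : conthom >-> Funclass.

Section Pullback.
Variables (Pi G : topGroupType) (A : zmodType) (rho : conthom Pi G).

Definition rho2 (x : Pi * Pi) : G * G := (rho x.1, rho x.2).
Definition rho3 (x : Pi * Pi * Pi) : G * G * G := (rho2 x.1, rho x.2).

Lemma conthom_continuous : continuous rho.
Proof. by have /asboolP[] := valP rho. Qed.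

Lemma conthomM a b : rho (a * b)%g = (rho a * rho b)%g.
Proof. by have /asboolP[_] := valP rho; exact. Qed.

Lemma rho2_continuous : continuous rho2.
Proof.
move=> x.
apply: (@cvg_pair _ _ _ (nbhs x) _ _ _ _ _ (fun y => rho y.1)
  (fun y => rho y.2)).
  apply: (@cvg_comp _ _ _ (@fst Pi Pi) rho (nbhs x) (nbhs x.1)).
    exact: cvg_fst.
  exact: conthom_continuous.
apply: (@cvg_comp _ _ _ (@snd Pi Pi) rho (nbhs x) (nbhs x.2)).
  exact: cvg_snd.
exact: conthom_continuous.
Qed.

Definition pull1 (f : C1 G A) : C1 Pi A :=
  exist _ (val f \o rho) (lc_comp conthom_continuous (valP f)).

Definition pull2 (f : C2 G A) : C2 Pi A :=
  exist _ (val f \o rho2) (lc_comp rho2_continuous (valP f)).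

Lemma pull2B (f g : C2 G A) : pull2 (f - g) = pull2 f - pull2 g.
Proof. exact: val_inj. Qed.

Lemma pull2_B2 f : f \in @B2 G A -> pull2 f \in @B2 Pi A.
Proof.
move=> /asboolP[g gE]; apply/asboolP; exists (pull1 g).
by apply/funext => -[a b]; rewrite /= gE /= conthomM.
Qed.

Lemma d2_pull2 (f : C2 G A) : d2 (val (pull2 f)) = d2 (val f) \o rho3.
Proof. by apply/funext => -[[a b] e]; rewrite /= /rho2 /= !conthomM. Qed.

(* independent of the representative: see pullq_class *)
Definition pullq (x : C2B2 G A) : C2B2 Pi A := class2 (pull2 (repr x)).

Lemma pullq_class f : pullq (class2 f) = class2 (pull2 f).
Proof.
apply/eqP; rewrite /pullq /class2 -idealrBE -pull2B; apply: pull2_B2.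
by rewrite idealrBE reprK.
Qed.

End Pullback.

Section Conjugation.
Variables (Pi G : topGroupType).

Lemma conthom_conj_subproof (rho : conthom Pi G) (g : G) :
  (fun a => (rho a ^ g)%g) \in @conthom_pred Pi G.
Proof.
apply/asboolP; split=> [|a b]; last by rewrite conthomM conjMg.
move=> a; rewrite /conjg.
apply: (@continuous2_cvg _ _ _ _ (nbhs a) _ _ _ (fun x y : G => (x * y)%g)
  (g^-1)%g (rho a * g)%g).
- exact: (@mulg_continuous G (_, _)).
- exact: cvg_cst.
apply: (@continuous2_cvg _ _ _ _ (nbhs a) _ _ _ (fun x y : G => (x * y)%g)
  (rho a) g).
- exact: (@mulg_continuous G (_, _)).
- exact: conthom_continuous.
- exact: cvg_cst.
Qed.

(* rho.g = g^-1 rho g *)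
Definition conthom_conj (rho : conthom Pi G) (g : G) : conthom Pi G :=
  exist (fun f => f \in @conthom_pred Pi G) _ (conthom_conj_subproof rho g).

End Conjugation.

(* For a torsor T under M with action act, torsor_sub act s t is s - t, the    *)
(* unique m such that s = t.m.                                               *)
Definition torsor_sub (T : Type) (M : zmodType) (act : T -> M -> T)
  (s t : T) : M := xget 0 [set m | s = act t m].

Section Torsor.
Variables (N : nat) (G : finGroupType).
Local Notation D := (discrete_topology G).
Variables (c : D * D * D -> 'Z_N) (Pi : topGroupType).
Local Notation Zn := ('Z_N : zmodType).

Definition h_fun (g : D) : D * D -> 'Z_N :=
  fun '(g1, g2) => c (g, (g1 ^ g)%g, (g2 ^ g)%g) - c (g1, g, (g2 ^ g)%g)
                   + c (g1, g2, g).

Lemma discrete_lc2 (f : D * D -> 'Z_N) : f \in @lcfun_pred (D * D)%type 'Z_N.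
Proof.
apply/asboolP => x; apply: (@filterS _ (nbhs x) _ [set x]).
  by move=> y ->.
exact: discrete_pair_nbhs1.
Qed.

Definition h_cochain (g : D) : C2 D 'Z_N := exist _ (h_fun g) (discrete_lc2 _).
Definition h_class (g : D) : C2B2 D 'Z_N := class2 (h_cochain g).

Lemma d2_h (hc : d3 c = 0) g a b e :
  d2 (h_fun g) (a, b, e) = c ((a ^ g)%g, (b ^ g)%g, (e ^ g)%g) - c (a, b, e).
Proof.
have E x y z t : d3 c (x, y, z, t) = 0 by rewrite hc.
move: (E g (a ^ g) (b ^ g) (e ^ g))%g (E a g (b ^ g) (e ^ g))%g.
move: (E a b g (e ^ g))%g (E a b e g)%g; rewrite /d3 /d2 /h_fun -!conjgC !conjMg.
move=> e3 e4 e1 e2; apply/eqP; rewrite -subr_eq0; apply/eqP.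
match type of e1 with ?E1 = _ => match type of e2 with ?E2 = _ =>
match type of e3 with ?E3 = _ => match type of e4 with ?E4 = _ =>
  transitivity (- E1 + E2 - E3 + E4)
end end end end; last by rewrite e1 e2 e3 e4 !oppr0 !addr0.
ring.
Qed.

Definition L_pred (rho : conthom Pi D) : {pred C2B2 Pi 'Z_N} := fun x =>
  `[< exists b : C2 Pi 'Z_N, d2 (val b) = c \o rho3 rho /\ x = class2 b >].

Definition Ltorsor (rho : conthom Pi D) :=
  {x : C2B2 Pi 'Z_N | x \in L_pred rho}.

Lemma L_add_subproof rho (t : Ltorsor rho) (z : H2 Pi 'Z_N) :
  val t + val z \in L_pred rho.
Proof.
have /asboolP[b [bE ->]] := valP t; have /asboolP[y [yE ->]] := valP z.
apply/asboolP; exists (b + y); rewrite /class2 !raddfD; split=> //.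
by rewrite d2D bE yE addr0.
Qed.

Definition L_add rho (t : Ltorsor rho) (z : H2 Pi 'Z_N) : Ltorsor rho :=
  exist (fun x => x \in L_pred rho) _ (L_add_subproof t z).

Hypothesis hc : d3 c = 0.

Lemma L_conj_subproof rho (t : Ltorsor rho) (g : D) :
  val t + pullq rho (h_class g) \in L_pred (conthom_conj rho g).
Proof.
have /asboolP[b [bE ->]] := valP t; apply/asboolP.
exists (b + pull2 rho (h_cochain g)).
rewrite pullq_class /class2 !raddfD; split=> //; rewrite d2D bE d2_pull2.
apply/funext => -[[u v] w]; rewrite [LHS]/(_ + _)/=.
rewrite -[LHS]/(c (rho u, rho v, rho w) +
  d2 (h_fun g) (rho u, rho v, rho w)) d2_h //.
by rewrite addrC subrK.
Qed.

(* The G-action on the disjoint union of the L(rho). *)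
Definition L_conj rho (t : Ltorsor rho) (g : D) : Ltorsor (conthom_conj rho g) :=
  exist (fun x => x \in L_pred _) _ (L_conj_subproof t g).

Section Invariant.
Variable inv : H2 Pi 'Z_N -> 'Z_N.

(* t.m = t + z, where inv z = m *)
Definition L_act rho (t : Ltorsor rho) (m : 'Z_N) : Ltorsor rho :=
  L_add t (xget 0 [set z | inv z = m]).

Definition lambda (x : forall rho, Ltorsor rho) (g : D) (rho : conthom Pi D) :
    'Z_N :=
  torsor_sub (@L_act _) (L_conj (x rho) g) (x (conthom_conj rho g)).

End Invariant.

End Torsor.

Section MapModule.
Variables (Pi G : topGroupType) (A : zmodType).

Definition map_act (g : G) (psi : conthom Pi G -> A) : conthom Pi G -> A :=
  fun rho => psi (conthom_conj rho g).

End MapModule.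

Definition is_Z1 (G : groupType) (M : zmodType) (act : G -> M -> M)
    (f : G -> M) :=
  forall g g', f (g * g')%g = f g + act g (f g').

Section GaloisGroup.
Variables (K L : fieldType) (iota : {rmorphism K -> L}).

Definition Gal_pred : {pred L -> L} := fun s =>
  `[< [/\ GRing.zmod_morphism s, GRing.monoid_morphism s, bijective s
        & forall a, s (iota a) = iota a] >].

Definition absGal := {s : L -> L | s \in Gal_pred}.
HB.instance Definition _ := SubChoice.on absGal.
Definition Gal_fun (s : absGal) : L -> L := val s.
Coercion Gal_fun : absGal >-> Funclass.

Lemma GalP (s : absGal) : [/\ GRing.zmod_morphism s, GRing.monoid_morphism s,
  bijective s & forall a, s (iota a) = iota a].
Proof. exact/asboolP/(valP s). Qed.

Lemma Gal_inj (s t : absGal) : s =1 t -> s = t.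
Proof. by move=> st; apply/val_inj/funext. Qed.

Lemma Gal_one_subproof : id \in Gal_pred.
Proof. by apply/asboolP; split=> //; exists id. Qed.
Definition Gal_one : absGal := exist (fun s => s \in Gal_pred) _ Gal_one_subproof.

Lemma Gal_mul_subproof (s t : absGal) : s \o t \in Gal_pred.
Proof.
have [sB sM sbij sK] := GalP s; have [tB tM tbij tK] := GalP t.
apply/asboolP; split.
- by move=> x y /=; rewrite tB sB.
- by split=> [|x y] /=; [rewrite tM.1 sM.1|rewrite tM.2 sM.2].
- exact: bij_comp.
- by move=> a /=; rewrite tK sK.
Qed.
Definition Gal_mul (s t : absGal) : absGal :=
  exist (fun s => s \in Gal_pred) _ (Gal_mul_subproof s t).

Definition Gal_inv_fun (s : absGal) (y : L) : L := xget 0 [set x | s x = y].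

Lemma Gal_inv_funK (s : absGal) : cancel (Gal_inv_fun s) s.
Proof.
move=> y; rewrite /Gal_inv_fun.
case: xgetP => [x -> //|/(_ _) H].
have [_ _ [t _ st] _] := GalP s.
by have := H (t y); rewrite /= st.
Qed.

Lemma Gal_funK (s : absGal) : cancel s (Gal_inv_fun s).
Proof.
have [_ _ /bij_inj sinj _] := GalP s.
by move=> x; apply: sinj; rewrite Gal_inv_funK.
Qed.

Lemma Gal_inv_subproof (s : absGal) : Gal_inv_fun s \in Gal_pred.
Proof.
have [sB sM sbij sK] := GalP s; have sinj := bij_inj sbij.
apply/asboolP; split.
- by move=> x y; apply: sinj; rewrite sB !Gal_inv_funK.
- split=> [|x y]; apply: sinj; first by rewrite Gal_inv_funK sM.1.
  by rewrite sM.2 !Gal_inv_funK.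
- by exists s; [exact: Gal_inv_funK|exact: Gal_funK].
- by move=> a; apply: sinj; rewrite Gal_inv_funK sK.
Qed.
Definition Gal_inv (s : absGal) : absGal :=
  exist (fun s => s \in Gal_pred) _ (Gal_inv_subproof s).

Lemma Gal_mulA : associative Gal_mul.
Proof. by move=> s t u; apply: Gal_inj. Qed.
Lemma Gal_mul1 : left_id Gal_one Gal_mul.
Proof. by move=> s; apply: Gal_inj. Qed.
Lemma Gal_1mul : right_id Gal_one Gal_mul.
Proof. by move=> s; apply: Gal_inj. Qed.
Lemma Gal_mulV : left_inverse Gal_one Gal_inv Gal_mul.
Proof. by move=> s; apply: Gal_inj => x; exact: Gal_funK. Qed.
Lemma Gal_Vmul : right_inverse Gal_one Gal_inv Gal_mul.
Proof. by move=> s; apply: Gal_inj => x; exact: Gal_inv_funK. Qed.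

HB.instance Definition _ :=
  isGroup.Build absGal Gal_mulA Gal_mul1 Gal_1mul Gal_mulV Gal_Vmul.

(* Krull topology: a basis of neighbourhoods of s is given by the sets of the *)
(* t that agree with s on a finite subset of L.                              *)
Definition Krull_open : set_system absGal := [set U : set absGal |
  forall s, U s -> exists E : seq L,
    forall t : absGal, {in E, t =1 s} -> U t].

Lemma Krull_openT : Krull_open setT.
Proof. by move=> s _; exists [::]. Qed.

Lemma Krull_openI : setI_closed Krull_open.
Proof.
move=> U V oU oV s [/oU[E EU] /oV[F FV]]; exists (E ++ F) => t ts.
by split; [apply: EU|apply: FV] => x xE; apply: ts; rewrite mem_cat xE ?orbT.
Qed.

Lemma Krull_open_bigU (I : Type) (f : I -> set absGal) :
  (forall i, Krull_open (f i)) -> Krull_open (\bigcup_i f i).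
Proof.
move=> of_ s [i _ /of_[E EU]]; exists E => t ts; exists i => //; exact: EU.
Qed.

HB.instance Definition _ :=
  isOpenTopological.Build absGal Krull_openT Krull_openI Krull_open_bigU.

Lemma Krull_nbhs (s : absGal) (U : set absGal) :
  nbhs s U <-> exists E : seq L, forall t : absGal, {in E, t =1 s} -> U t.
Proof.
split=> [[V [oV Vs VU]]|[E EU]].
  by have [E EV] := oV s Vs; exists E => t /EV /VU.
exists [set t : absGal | {in E, t =1 s}]; split=> // t ts; exists E => u ut x xE.
by rewrite ut // ts.
Qed.

Lemma Gal_mul_continuous : continuous (fun x : absGal * absGal => (x.1 * x.2)%g).
Proof.
move=> [s t] U /= /Krull_nbhs[E EU].
exists ([set u : absGal | {in map (Gal_fun t) E, u =1 Gal_fun s}],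
        [set u : absGal | {in E, u =1 Gal_fun t}]).
  by split; apply/Krull_nbhs; [exists (map (Gal_fun t) E)|exists E].
move=> [u v] /= [us vt]; apply: EU => x xE /=.
rewrite -[LHS]/(Gal_fun u (Gal_fun v x)).
rewrite -[RHS]/(Gal_fun s (Gal_fun t x)) vt // us //.
exact: map_f.
Qed.

Lemma Gal_inv_continuous : continuous (fun x : absGal => (x^-1)%g).
Proof.
move=> s U /= /Krull_nbhs[E EU]; apply/Krull_nbhs.
exists (map (Gal_inv_fun s) E) => u us; apply: EU => x xE.
rewrite -[LHS]/(Gal_inv_fun u x) -[RHS]/(Gal_inv_fun s x).
by rewrite -[x in LHS](Gal_inv_funK s) -us ?Gal_funK // map_f.
Qed.

HB.instance Definition _ :=
  isTopologicalGroup.Build absGal Gal_mul_continuous Gal_inv_continuous.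

End GaloisGroup.

Section NumberField.
Variable k : fieldExtType rat.

Definition algint_pred : {pred k} :=
  fun x => `[< integralOver (intr : int -> k) x >].

Lemma algint_subring_closed : subring_closed algint_pred.
Proof.
split; first exact/asboolP/integral1.
  by move=> x y /asboolP ix /asboolP iy; apply/asboolP/integral_sub.
by move=> x y /asboolP ix /asboolP iy; apply/asboolP/integral_mul.
Qed.

HB.instance Definition _ := GRing.isSubringClosed.Build k algint_pred
  algint_subring_closed.

Definition algint := {x : k | x \in algint_pred}.
HB.instance Definition _ := SubChoice.on algint.
HB.instance Definition _ := [SubChoice_isSubComNzRing of algint by <:].

Definition is_finite_prime (P : prime_idealr algint) :=
  exists2 a : algint, a \in P & a != 0.

(* membership in the ideal power I^n *)
Fixpoint ideal_pow (R : comNzRingType) (I : {pred R}) (n : nat) (a : R) : Prop :=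
  if n is n'.+1 then
    exists (m : nat) (u v : 'I_m -> R),
      [/\ forall i, u i \in I, forall i, ideal_pow I n' (v i)
        & a = \sum_(i < m) u i * v i]
  else True.

(* A value v 0 is junk; val_ge v n x means that x has valuation at least n.  *)
Definition val_ge (K : fieldType) (v : K -> int) (n : int) (x : K) :=
  x = 0 \/ n <= v x.

(* The completion of k at P: a field complete for a normalised discrete      *)
(* valuation, in which k is dense and whose valuation restricts to the       *)
(* P-adic one on the ring of integers of k.                                  *)
Record completion (P : prime_idealr algint) := Completion {
  cfield :> fieldType;
  cval : cfield -> int;
  cemb : {rmorphism k -> cfield};
  cvalM : forall x y, x != 0 -> y != 0 -> cval (x * y) = cval x + cval y;
  cvalD : forall n x y,
    val_ge cval n x -> val_ge cval n y -> val_ge cval n (x + y);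
  cval_uniformizer : exists2 x, x != 0 & cval x = 1;
  cval_adic : forall (n : nat) (a : algint),
    val_ge cval n (cemb (val a)) <-> ideal_pow P n a;
  cval_dense : forall n x, exists a, val_ge cval n (x - cemb a);
  cval_complete : forall u : nat -> cfield,
    (forall n, exists M, forall i j, (M <= i)%N -> (M <= j)%N ->
      val_ge cval n (u i - u j)) ->
    exists l, forall n, exists M, forall i, (M <= i)%N ->
      val_ge cval n (u i - l)
}.

End NumberField.

Record algclosure (K : fieldType) := AlgClosure {
  acfield :> closedFieldType;
  acemb : {rmorphism K -> acfield};
  ac_algebraic : forall x, algebraicOver acemb x
}.

Section LocalInvariant.
Variables (k : fieldExtType rat) (P : prime_idealr (algint k)).
Variables (K : completion P) (Kbar : algclosure K).
Local Notation v := (@cval _ _ K).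
Local Notation iota := (acemb Kbar).
Local Notation Pi := (absGal iota).

(* The valuation ring of Kbar is the integral closure of that of K.          *)
Definition integral_bar (x : Kbar) := exists p : {poly K},
  [/\ p \is monic, forall i, val_ge v 0 p`_i & root (map_poly iota p) x].

Definition maximal_bar (x : Kbar) :=
  integral_bar x /\ (x = 0 \/ ~ integral_bar x^-1).

Definition inertia (s : Pi) :=
  forall x, integral_bar x -> maximal_bar (s x - x).

(* q is the cardinality of the residue field of K *)
Definition residue_card (q : nat) := exists r : 'I_q -> K,
  (forall i, val_ge v 0 (r i)) /\
  (forall x, val_ge v 0 x -> exists! i, val_ge v 1 (x - r i)).

(* lifts to Pi of the arithmetic Frobenius automorphism *)
Definition frobenius (s : Pi) := exists2 q, residue_card q &
  forall x, integral_bar x -> maximal_bar (s x - x ^+ q).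

(* the maximal unramified extension of K *)
Definition unramified (x : Kbar) := forall s : Pi, inertia s -> s x = x.

(* n is the valuation of x, for x a nonzero element of the maximal unramified *)
(* extension: x is a unit times an element of K of valuation n.              *)
Definition unramified_val (x : Kbar) (n : int) := exists a : K,
  [/\ a != 0, v a = n, integral_bar (x / iota a) & integral_bar (iota a / x)].

(* loc_inv zeta z m: the 2-cocycle z has local invariant m.  The class of      *)
(* zeta^z in H^2(Pi, Kbar^* ) = Br K is represented by an inflated cocycle b  *)
(* with values in Kur^*; the class of the valuation of b in                  *)
(* H^2(Gal(Kur/K), Z) is the image of the character f mod Z under the        *)
(* connecting map of 0 -> Z -> Q -> Q/Z -> 0; the value of this character at *)
(* Frobenius is m / N in (1/N)Z/Z = Z/N.                                     *)
Definition loc_inv (N : nat) (zeta : Kbar) (z : C2 Pi 'Z_N) (m : 'Z_N) :=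
  exists (a : Pi -> Kbar) (b : Pi * Pi -> Kbar) (f : Pi -> rat),
  [/\ [/\ locally_constant a, locally_constant b & locally_constant f],
      [/\ forall s, a s != 0,
          forall s t, b (s, t) != 0 /\ unramified (b (s, t)),
          forall s t i j, inertia i -> inertia j ->
            b ((s * i)%g, (t * j)%g) = b (s, t)
        & forall s i, inertia i -> f (s * i)%g = f s],
      forall s t : Pi, zeta ^+ val z (s, t) =
        b (s, t) * (s (a t) * a s / a (s * t)%g),
      forall s t, exists2 n : int,
        unramified_val (b (s, t)) n & n%:~R = d1 f (s, t)
    & forall s, frobenius s ->
        f s - (m : nat)%:R / N%:R \is a Num.int].

(* inv is the local invariant isomorphism H^2(Pi, Z/N) = H^2(K, mu_N) -> Z/N, *)
(* Z/N being identified with mu_N by m |-> zeta^m.                           *)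
Record is_local_invariant (N : nat) (zeta : Kbar) (inv : H2 Pi 'Z_N -> 'Z_N) :
    Prop := IsLocalInvariant {
  linv_additive : {morph inv : x y / x + y};
  linv_bijective : bijective inv;
  linvE : forall (z : C2 Pi 'Z_N) (x : H2 Pi 'Z_N) (m : 'Z_N),
    d2 (val z) = 0 -> val x = class2 z -> (inv x = m <-> loc_inv zeta z m)
}.

End LocalInvariant.

(* Main.v *)
(* The cochains h_g satisfy h_{gg'} = h_g + (h_{g'} conjugated by g) modulo a *)
(* coboundary, so the formula for the action on the torsors L(rho) is a right *)
(* action of G. The cocycle identity is then the additivity of torsor         *)
(* differences: x(rho).gg' differs from x(rho.g).g' by lambda(g, rho), which  *)
(* differs from x(rho.gg') by lambda(g', rho.g).                              *)

Require Import Defs.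
From mathcomp Require Import all_boot all_order all_fingroup all_algebra.
From mathcomp Require Import all_field.
From mathcomp Require Import ring_quotient complex.
From mathcomp Require Import all_classical reals topology.
From mathcomp Require Import ring.

Set Implicit Arguments.
Unset Strict Implicit.
Unset Printing Implicit Defensive.

Import GRing.Theory.

Local Open Scope ring_scope.

(** Through the inverse of [inv], a torsor difference becomes an ordinary difference in C^2/B^2 of
    [Pi] ([torsor_subE]), so [lambda] at g, rho is x(rho) + h_g o rho - x(rho.g). The identity then
    telescopes once h_{gg'} o rho = h_g o rho + h_{g'} o (rho.g) modulo B^2 ([pullq_h_classM]),
    which [h_funM] deduces from the cocycle condition on [c]. *)

Lemma discrete_lc1 (G : finGroupType) (A : zmodType)
  (f : discrete_topology G -> A) : f \in @lcfun_pred (discrete_topology G) A.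
Proof.
apply/asboolP => x; apply: (@filterS _ (nbhs x) _ [set x]%classic).
  by move=> y ->.
exact: discrete_nbhs1.
Qed.

Section ConjugationCocycle.
Variables (N : nat) (G : finGroupType).
Local Notation D := (discrete_topology G).
Variables (c : D * D * D -> 'Z_N) (c_cocycle : d3 c = 0).

(** Signed sum of [c] over the three shuffles of (g, g') with a, where a is conjugated by those of
    g, g' that precede it. *)
Definition h_defect (g g' a : D) : 'Z_N :=
  c (g, g', (a ^ (g * g'))%g) - c (g, (a ^ g)%g, g') + c (a, g, g').

(* The signed sum of the cocycle identity for c over the six shuffles of      *)
(* (g, g') and (a, b), each entry being conjugated by those of g, g' that it  *)
(* has been moved past.                                                       *)
Lemma h_funM g g' a b :
  h_fun c (g * g')%g (a, b) =
  h_fun c g (a, b) + h_fun c g' ((a ^ g)%g, (b ^ g)%g)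
  + d1 (h_defect g g') (a, b).
Proof.
have E x y z t : d3 c (x, y, z, t) = 0 by rewrite c_cocycle.
move: (E g g' ((a ^ g) ^ g') ((b ^ g) ^ g'))%g.
move: (E g (a ^ g) g' ((b ^ g) ^ g'))%g.
move: (E g (a ^ g) (b ^ g) g')%g (E a g g' ((b ^ g) ^ g'))%g.
move: (E a g (b ^ g) g')%g (E a b g g')%g.
rewrite /d3 /d1 /h_fun /h_defect !conjgM -!conjgC -!conjMg.
move=> e5 e6 e3 e4 e2 e1; apply/eqP; rewrite -subr_eq0; apply/eqP.
match type of e1 with ?E1 = _ => match type of e2 with ?E2 = _ =>
match type of e3 with ?E3 = _ => match type of e4 with ?E4 = _ =>
match type of e5 with ?E5 = _ => match type of e6 with ?E6 = _ =>
  transitivity (- E1 + E2 - E3 - E4 + E5 - E6)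
end end end end end end.
  ring.
by rewrite e1 e2 e3 e4 e5 e6 !oppr0 !addr0.
Qed.

Variable Pi : topGroupType.
Implicit Types rho : conthom Pi D.

Lemma conthom_conjM rho g g' :
  conthom_conj rho (g * g')%g = conthom_conj (conthom_conj rho g) g'.
Proof. by apply/val_inj/funext => a /=; rewrite conjgM. Qed.

(** Evaluating [h_funM] at values of [rho] turns the arguments conjugated by g into values of rho.g;
    the error term is the coboundary of the pulled-back [h_defect]. *)
Lemma pullq_h_classM rho g g' :
  pullq rho (h_class c (g * g')%g) =
  pullq rho (h_class c g) + pullq (conthom_conj rho g) (h_class c g').
Proof.
rewrite !pullq_class /class2 -raddfD; apply/eqP; rewrite -Quotient.idealrBE.
pose defect : C1 D 'Z_N :=
  exist (fun f => f \in @lcfun_pred D 'Z_N) _ (discrete_lc1 (h_defect g g')).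
apply/asboolP; exists (pull1 rho defect).
apply/funext => -[a b]; rewrite /= conthomM.
have := h_funM g g' (rho a) (rho b).
rewrite /d1 => /= h; rewrite -[LHS]/(h_fun c (g * g')%g (rho a, rho b) -
  (h_fun c g (rho a, rho b) + h_fun c g' ((rho a ^ g)%g, (rho b ^ g)%g))).
by rewrite /= h addrAC subrr add0r.
Qed.

Lemma Ltorsor_subP rho (s t : Ltorsor c rho) :
  val s - val t \in @H2_pred Pi 'Z_N.
Proof.
have /asboolP[b [bE ->]] := valP s; have /asboolP[b' [b'E ->]] := valP t.
apply/asboolP; exists (b - b').
by rewrite /class2 !raddfB /= d2B bE b'E subrr.
Qed.

Variables (inv : H2 Pi 'Z_N -> 'Z_N) (inv' : 'Z_N -> H2 Pi 'Z_N).
Hypotheses (invK : cancel inv inv') (inv'K : cancel inv' inv).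

Lemma val_L_act rho (t : Ltorsor c rho) m :
  val (L_act inv t m) = val t + val (inv' m).
Proof.
rewrite /L_act; case: xgetP => [z _ <-|/(_ (inv' m))[]]; first by rewrite invK.
exact: inv'K.
Qed.

Lemma torsor_subE rho (s t : Ltorsor c rho) :
  val (inv' (torsor_sub (@L_act _ _ c _ inv rho) s t)) = val s - val t.
Proof.
rewrite /torsor_sub; case: xgetP => [m _ ->|].
  by rewrite val_L_act addrC addKr.
(* The default 0 of [xget] never occurs: [inv z] is a valid difference. *)
pose z : H2 Pi 'Z_N :=
  exist (fun x => x \in @H2_pred Pi 'Z_N) _ (Ltorsor_subP s t).
move=> /(_ (inv z)) []; apply: val_inj.
by rewrite val_L_act invK /= addrC subrK.
Qed.

Hypothesis invD : {morph inv : y z / y + z}.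
Variable x : forall rho, Ltorsor c rho.

Lemma val_lambda g rho :
  val (inv' (lambda c_cocycle inv x g rho)) =
  val (x rho) + pullq rho (h_class c g) - val (x (conthom_conj rho g)).
Proof. exact: torsor_subE. Qed.

Lemma lambda_cocycle g g' :
  lambda c_cocycle inv x (g * g')%g =
  lambda c_cocycle inv x g + map_act g (lambda c_cocycle inv x g').
Proof.
apply/funext => rho; apply: (can_inj inv'K).
have inv'D m n : inv' (m + n) = inv' m + inv' n.
  by apply: (can_inj invK); rewrite invD !inv'K.
rewrite -[RHS]/(inv' (lambda c_cocycle inv x g rho
  + lambda c_cocycle inv x g' (conthom_conj rho g))) inv'D.
(* C^2/B^2 does not depend on [rho], so rho.(gg') can be rewritten as (rho.g).g' without transport
   between torsors; the terms x(rho.g) cancel. *)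
apply: val_inj; rewrite raddfD /= !val_lambda conthom_conjM pullq_h_classM.
by rewrite !addrA subrK.
Qed.

End ConjugationCocycle.

Theorem theorem2p1p13
  (N : nat) (N_gt1 : (1 < N)%N)
  (R : realType) (zetaN : R[i]) (zetaN_prim : N.-primitive_root zetaN)
  (k : fieldExtType rat) (emb : {rmorphism k -> R[i]})
  (mu_k : forall z : R[i], z ^+ N = 1 -> exists a : k, emb a = z)
  (zeta : k) (zetaE : emb zeta = zetaN)
  (G : finGroupType)
  (c : discrete_topology G * discrete_topology G * discrete_topology G -> 'Z_N)
  (c_cocycle : d3 c = 0)
  (P : prime_idealr (algint k)) (P_finite : is_finite_prime P)
  (kp : completion P) (kpbar : algclosure kp)
  (inv : H2 (absGal (acemb kpbar)) 'Z_N -> 'Z_N)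
  (inv_local : is_local_invariant (acemb kpbar (cemb kp zeta)) inv)
  (x : forall rho : conthom (absGal (acemb kpbar)) (discrete_topology G), Ltorsor c rho) :
  (forall g g' : discrete_topology G,
     lambda c_cocycle inv x (g * g')%g =
     lambda c_cocycle inv x g + map_act g (lambda c_cocycle inv x g')) /\
  is_Z1 (@map_act (absGal (acemb kpbar)) (discrete_topology G) 'Z_N)
    (lambda c_cocycle inv x).
Proof.
have [inv' invK inv'K] := linv_bijective inv_local.
have lambdaM := lambda_cocycle c_cocycle invK inv'K (linv_additive inv_local) x.
by split.
Qed.
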